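(* For every integer $n\ge 1$, the Ehrhart polynomial $H_{3,n}$ has all its complex roots on the line $R=\{z\in\mathbb{C}:\operatorname{Re}(z)=-\tfrac12\}$ and is $R$-interlaced by $H_{2,n}$.
   Context: For a finite simple undirected graph $G=(V,E)$, let $\mathbb{Z}^{|V|}$ be the lattice with basis $(e_v)_{v\in V}$. The symmetric edge polytope $P_G\subset\mathbb{R}^{|V|}$ is the convex hull of all vectors $e_{v_1}-e_{v_2}$ with $\{v_1,v_2\}\in E$ (both orders). The Ehrhart polynomial $H_G$ is the polynomial with $H_G(s)=|sP_G\cap\mathbb{Z}^{|V|}|$ for all integers $s\ge 0$. For the complete bipartite graph $K_{a,b}$ with parts of sizes $a$ and $b$, write $H_{a,b}=H_{K_{a,b}}$. Interlacing: let $L=\alpha+\mathbb{R}\beta$ be a line in $\mathbb{C}$ ($\alpha,\beta\in\mathbb{C}$, $\beta\ne0$), and let $f,g\in\mathbb{C}[x]$ with $m=\deg f=\deg g+1$ have all their zeros on $L$. Let $\alpha+t_1\beta,\dots,\alpha+t_m\beta$ and $\alpha+s_1\beta,\dots,\alpha+s_{m-1}\beta$ ($t_i,s_j\in\mathbb{R}$) be the zeros of $f$ and $g$, listed with multiplicity. Then $f$ is $L$-interlaced by $g$ (equivalently, $g$ $L$-interlaces $f$) if, after relabeling, $t_1\le s_1\le t_2\le\cdots\le t_{m-1}\le s_{m-1}\le t_m$. *)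

(* Defs.v *)
From HB Require Import structures.
From mathcomp Require Import all_boot all_order all_algebra.
From mathcomp Require Import all_classical reals convex.
From mathcomp Require Import complex.

Set Implicit Arguments.
Unset Strict Implicit.
Unset Printing Implicit Defensive.

Import Order.TTheory GRing.Theory Num.Theory.

Local Open Scope classical_set_scope.
Local Open Scope ring_scope.
Local Open Scope complex_scope.

Record sgraph := SGraph {
  vertex : finType;
  adj : rel vertex;
  adj_sym : symmetric adj;
  adj_irrefl : irreflexive adj }.

Definition Kbip_adj (a b : nat) : rel ('I_a + 'I_b)%type :=
  fun u v => match u, v with
             | inl _, inr _ | inr _, inl _ => true
             | _, _ => false
             end.

Lemma Kbip_adj_sym a b : symmetric (@Kbip_adj a b).
Proof. by move=> [u|u] [v|v]. Qed.

Lemma Kbip_adj_irrefl a b : irreflexive (@Kbip_adj a b).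
Proof. by move=> [u|u]. Qed.

Definition Kbip (a b : nat) : sgraph :=
  SGraph (@Kbip_adj_sym a b) (@Kbip_adj_irrefl a b).

Definition convex_hull (R : numDomainType) (M : lmodType R) (A : set M)
    : set M :=
  smallest (@convex_set R M) A.

Section Ehrhart.
Variables (R : realType) (G : sgraph).

Local Notation V := (vertex G).

(* The regular module R^o, rather than R, gives {ffun V -> R^o} its
   R-module structure. *)
Definition basis_vec (v : V) : {ffun V -> R^o} := [ffun u => (u == v)%:R].

Definition edge_polytope : set {ffun V -> R^o} :=
  convex_hull [set x | exists u v : V,
                         adj u v /\ x = basis_vec u - basis_vec v].

Definition dilated_lattice_points (s : nat) : set {ffun V -> R^o} :=
  [set s%:R *: x | x in edge_polytope]
    `&` [set x | forall v, (x v : R) \is a Num.int].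

Definition is_ehrhart (H : {poly R[i]}) : Prop :=
  forall s : nat, exists k : nat,
    (dilated_lattice_points s #= `I_k)%card /\ H.[s%:R] = k%:R.

Lemma is_ehrhart_uniq (H1 H2 : {poly R[i]}) :
  is_ehrhart H1 -> is_ehrhart H2 -> H1 = H2.
Proof.
move=> h1 h2; apply/eqP; rewrite -subr_eq0; apply/negPn/negP => nz.
pose rs : seq R[i] := [seq s%:R | s <- iota 0 (size (H1 - H2))].
have uniq_rs : uniq rs.
  by rewrite map_inj_uniq ?iota_uniq // => i j /eqP; rewrite eqr_nat => /eqP.
have roots_rs : all (root (H1 - H2)) rs.
  apply/allP => _ /mapP[s _ ->]; rewrite rootE hornerD hornerN.
  have [k1 [c1 ->]] := h1 s; have [k2 [c2 ->]] := h2 s.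
  suff -> : k1 = k2 by rewrite subrr.
  by apply/card_eq_II; rewrite -(card_eql c1).
by have := max_poly_roots nz roots_rs uniq_rs; rewrite size_map size_iota ltnn.
Qed.

(* The default value 0 is returned only if there is no Ehrhart polynomial. *)
Definition ehrhart_poly : {poly R[i]} := xget 0 [set H | is_ehrhart H].

Lemma ehrhart_polyE (H : {poly R[i]}) : is_ehrhart H -> ehrhart_poly = H.
Proof. by move=> hH; apply: xget_unique => // H' hH'; exact: is_ehrhart_uniq. Qed.

End Ehrhart.

Section Interlacing.
Variable R : realType.
Implicit Types (L : set R[i]) (f g : {poly R[i]}) (zs : seq R[i]).

Definition lists_zeros f zs : Prop :=
  f != 0 /\ forall z, count_mem z zs = mup z f.

Definition line_point (alpha beta : R[i]) (t : R) : R[i] :=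
  alpha + t%:C * beta.

(* [interlaced L f g] : f is L-interlaced by g.  That all zeros of f and g lie
   on L is implied by their being listed as points of L, and that t has one
   more entry than s is implied by size f = (size g).+1, R[i] being
   algebraically closed. *)
Definition interlaced L f g : Prop :=
  exists alpha beta : R[i],
    [/\ beta != 0,
        L = range (line_point alpha beta),
        size f = (size g).+1
      & exists t s : seq R,
          [/\ lists_zeros f (map (line_point alpha beta) t),
              lists_zeros g (map (line_point alpha beta) s)
            & forall j, (j < size s)%N -> t`_j <= s`_j <= t`_j.+1]].

Definition critical_line : set R[i] := [set z | complex.Re z = - 2^-1].

End Interlacing.

Arguments critical_line R : clear implicits.

(* Main.v *)
Require Import Defs.
From HB Require Import structures.
From mathcomp Require Import all_boot all_order all_algebra.
From mathcomp Require Import all_classical reals convex.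
From mathcomp Require Import interval_inference.
From mathcomp Require Import complex polyrcf.
From mathcomp Require Import zify ring lra.

(** For [K_{a,n}] the gauge of the polytope at [(y, z)] is [max (|y|_1, |z|_1)], so
    the lattice points of [s P] are the integer pairs [(y, z)] with
    [sum y + sum z = 0], [|y|_1 <= s] and [|z|_1 <= s].  For [a = 2, 3] the number
    of [y] with a prescribed sum [- k], [|k| <= s], is [s + e], respectively
    [(3 (s + e)^2 + 1 - k^2) / 4], with [e = 1] if [k] and [s] have the same parity
    and [e = 0] otherwise.  Summing over [z] expresses [H_{2,n}] and [H_{3,n}]
    through the Ehrhart polynomials [C_n], [C_{n-1}] of cross-polytopes, which
    satisfy [n C_n = w C_{n-1} + (n - 1) C_{n-2}] with [w = 2 s + 1].  On the
    critical line, [w = i y] with [y] real, [C_n = i^n q_n (y)] for real orthogonal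
    polynomials [q_n], and up to constants [H_{2,n}] and [H_{3,n}] become
    [A = y q_n - q_{n-1}] and a polynomial [E] that equals a negative multiple of
    [q_n] at the zeros of [A].  Comparing signs at consecutive zeros shows that
    each of [q_{n-1}], [q_n], [A], [E] interlaces the next one. *)

Set Implicit Arguments.
Unset Strict Implicit.
Unset Printing Implicit Defensive.

Import Order.TTheory GRing.Theory Num.Theory.

Local Open Scope classical_set_scope.
Local Open Scope ring_scope.
Local Open Scope complex_scope.

(** * Interlacing of real polynomials *)

Definition alternate (F : rcfType) (t s : seq F) : Prop :=
  size t = (size s).+1 /\
  forall j, (j < size s)%N -> t`_j < s`_j < t`_j.+1.

(** The size conditions make [t] and [s] complete lists of zeros, all of them simple. The positive
    leading coefficients fix the signs outside the range of the zeros. *)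
Definition strictly_interlaced (F : rcfType) (f g : {poly F}) : Prop :=
  exists t s : seq F,
    [/\ alternate t s, all (root f) t, all (root g) s
      & [/\ size f = (size t).+1, size g = (size s).+1,
            0 < lead_coef f & 0 < lead_coef g]].

Lemma alternate_le (F : rcfType) (t s : seq F) i j :
  alternate t s -> (i <= j <= size s)%N -> t`_i <= t`_j.
Proof.
move=> [_ ts] /andP[ij js]; elim: j ij js => [|j IH].
  by rewrite leqn0 => /eqP ->.
rewrite leq_eqVlt => /orP[/eqP -> //|ij js].
apply: le_trans (IH ij (ltnW js)) _.
by have /andP[/lt_trans h /h /ltW] := ts _ js.
Qed.

Lemma alternate_lt (F : rcfType) (t s : seq F) i j :
  alternate t s -> (i < j <= size s)%N -> t`_i < t`_j.
Proof.
move=> ts /andP[ij js].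
apply: (@lt_le_trans _ _ t`_i.+1); last by apply: alternate_le ts _; rewrite ij.
by have /andP[/lt_trans h /h] := ts.2 _ (leq_trans ij js).
Qed.

Lemma alternate_uniql (F : rcfType) (t s : seq F) : alternate t s -> uniq t.
Proof.
move=> ts; apply/(uniqP 0) => i j; rewrite !inE ts.1 !ltnS => il jl eqt.
case: (ltngtP i j) => // ij.
  by have := alternate_lt (i := i) (j := j) ts; rewrite ij jl eqt ltxx => /(_ isT).
by have := alternate_lt (i := j) (j := i) ts; rewrite ij il eqt ltxx => /(_ isT).
Qed.

Lemma alternate_uniqr (F : rcfType) (t s : seq F) : alternate t s -> uniq s.
Proof.
move=> ts; apply/(uniqP 0) => i j; rewrite !inE.
wlog ij : i j / (i <= j)%N => [hw il jl e|il jl eqs].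
  by case: (leqP i j) => [/hw|/ltnW /hw h]; [apply|apply/esym/h].
move: ij; rewrite leq_eqVlt => /orP[/eqP //|ij].
have /andP[_ h1] := ts.2 _ il; have /andP[h2 _] := ts.2 _ jl.
have := alternate_le (i := i.+1) (j := j) ts; rewrite ij (ltnW jl) => /(_ isT) h.
by have := lt_trans (lt_le_trans h1 h) h2; rewrite eqs ltxx.
Qed.

(** Exactly the zeros [s_j] with [i <= j] exceed [t_i], so [size s - i] linear factors of [g] are
    negative there. *)
Lemma alternate_root_sign (F : rcfType) (t s : seq F) (g : {poly F}) i :
  alternate t s -> all (root g) s -> size g = (size s).+1 ->
  0 < lead_coef g -> (i <= size s)%N -> 0 < (-1) ^+ (size s - i) * g.[t`_i].
Proof.
move=> ts gs sg lg il.
rewrite (all_roots_prod_XsubC sg gs) ?uniq_rootsE ?(alternate_uniqr ts) //.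
rewrite hornerZ mulrCA mulr_gt0 //.
rewrite horner_prod (big_nth 0) (big_cat_nat (n := i)) //=.
rewrite mulrCA mulr_gt0 //.
  rewrite big_nat prodr_gt0 // => j /andP[_ ji].
  rewrite hornerXsubC subr_gt0.
  have /andP[_ /lt_le_trans] := ts.2 _ (leq_trans ji il); apply.
  by apply: alternate_le ts _; rewrite ji.
rewrite -prodr_const_nat -big_split /= big_nat prodr_gt0 // => j /andP[ij jl].
rewrite hornerXsubC mulN1r opprB subr_gt0.
have /andP[/(le_lt_trans _) h _] := ts.2 _ jl; apply: h.
by apply: alternate_le ts _; rewrite ij ltnW.
Qed.

Lemma poly_pos_far_right (F : rcfType) (f : {poly F}) (a : F) :
  0 < lead_coef f -> exists2 x, a < x & 0 < f.[x].
Proof.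
move=> lf; have [b fb] := poly_pinfty_gt_lc lf.
exists (Num.max b (a + 1)); first by rewrite lt_max ltrDl ltr01 orbT.
by apply: lt_le_trans lf (fb _ _); rewrite le_max lexx.
Qed.

(** The reflection [x -> - x], corrected by its sign on the leading coefficient, reduces this to
    [poly_pos_far_right]. *)
Lemma poly_sign_far_left (F : rcfType) (f : {poly F}) (a : F) :
  0 < lead_coef f -> exists2 x, x < a & 0 < (-1) ^+ (size f).-1 * f.[x].
Proof.
move=> lf; pose g := (-1) ^+ (size f).-1 *: (f \Po - 'X).
have lg : 0 < lead_coef g.
  rewrite lead_coefZ lead_coef_comp ?size_polyN ?size_polyX // lead_coefN.
  by rewrite lead_coefX mulrCA -exprMn mulrN1 opprK expr1n mulr1.
have [x ax gx] := poly_pos_far_right (- a) lg; exists (- x); first by rewrite ltrNl.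
by move: gx; rewrite /g hornerZ horner_comp hornerN hornerX.
Qed.

(* At the zeros of [g] the sign of [f] is opposite to the sign of [h], hence
   alternates; the intermediate value theorem does the rest. *)
Lemma strictly_interlaced_step (F : rcfType) (f g h : {poly F}) :
  strictly_interlaced g h -> size f = (size g).+1 -> 0 < lead_coef f ->
  (forall x, root g x -> h.[x] != 0 -> f.[x] * h.[x] < 0) -> strictly_interlaced f g.
Proof.
move=> [t [s [ts gt hs [sg sh lg lh]]]] sf lf fh.
have szt := ts.1.
have [L Lt fL] := poly_sign_far_left t`_0 lf.
have [U tU fU] := poly_pos_far_right t`_(size s) lf.
(* The points are [L], then the zeros of [g], and finally [U], which is reached as the default value
   of [nth]. *)
pose x j := nth U (L :: t) j.
have xS j : (j <= size s)%N -> x j.+1 = t`_j.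
  by move=> js; rewrite /x /=; apply: set_nth_default; rewrite szt.
have xlast : x (size s).+2 = U by rewrite /x /= nth_default ?szt.
have x_lt j : (j <= (size s).+1)%N -> x j < x j.+1.
  case: j => [|j]; first by rewrite xS.
  rewrite ltnS leq_eqVlt => /orP[/eqP -> |js]; first by rewrite xlast xS.
  by rewrite !xS ?(ltnW js) //; apply: alternate_lt ts _; rewrite ltnSn.
have x_sign j : (j <= (size s).+2)%N -> 0 < (-1) ^+ ((size s).+2 - j) * f.[x j].
  case: j => [|j]; first by move: fL; rewrite sf sg szt subn0.
  rewrite ltnS leq_eqVlt => /orP[/eqP -> |js].
    by rewrite xlast subnn expr0 mul1r.
  rewrite xS // subSS subSn // exprS mulN1r mulNr.
  have gtj : root g t`_j by apply: (allP gt); rewrite mem_nth ?szt.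
  have hsg := alternate_root_sign ts hs sh lh js.
  have htj : h.[t`_j] != 0.
    by apply: contraTneq hsg => ->; rewrite mulr0 ltxx.
  move: hsg (fh _ gtj htj).
  by rewrite -signr_odd !mulr_sign; case: odd => *; nra.
have /choice[r rP] : forall j, exists y, (j <= (size s).+1)%N ->
    x j < y < x j.+1 /\ root f y.
  move=> j; case: (leqP j (size s).+1) => [js|_]; last by exists 0.
  have hneg : f.[x j] * f.[x j.+1] < 0.
    have := x_sign j.+1 js; have := x_sign j (leqW js).
    rewrite subSS (subSn js) exprS mulN1r mulNr.
    by rewrite -signr_odd !mulr_sign; case: odd => *; nra.
  have [y xy ry] := poly_ivtoo (ltW (x_lt j js)) hneg.
  by exists y => _; move: xy; rewrite in_itv.
exists (mkseq r (size s).+2), t; split => //.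
- split=> [|j]; first by rewrite size_mkseq szt.
  rewrite szt ltnS => js; rewrite !nth_mkseq ?ltnS ?(leqW js) //.
  have [/andP[_ h1] _] := rP j (leqW js).
  have [/andP[h2 _] _] := rP j.+1 js.
  by move: h1 h2; rewrite xS // => -> ->.
- by apply/allP => y /mapP[j]; rewrite mem_iota add0n ltnS => js ->; case: (rP j js).
- by split=> //; rewrite sf sg size_mkseq szt.
Qed.

(** * The chain of interlacing polynomials on the real axis *)

Lemma lead_scaleMXD (F : realFieldType) (c : F) (g h : {poly F}) :
  0 < c -> 0 < lead_coef g -> (size h <= size g)%N ->
  size (c *: ('X * g) + h) = (size g).+1 /\ 0 < lead_coef (c *: ('X * g) + h).
Proof.
move=> c0 lg hg; have g0 : g != 0 by rewrite -lead_coef_eq0 gt_eqF.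
have sX : size (c *: ('X * g)) = (size g).+1.
  by rewrite size_scale ?gt_eqF // mulrC size_mulX.
have lt_sz : (size h < size (c *: ('X * g)))%N by rewrite sX.
split; first by rewrite size_polyDl.
by rewrite lead_coefDl // lead_coefZ mulrC lead_coefM lead_coefX mul1r mulr_gt0.
Qed.

(* Symmetric Meixner-Pollaczek polynomials: [q_n(y)] is, up to the factor
   [i^n], the Ehrhart polynomial of the [n]-dimensional cross-polytope at
   [(-1 + i y) / 2]. *)
Fixpoint meixner (F : fieldType) (n : nat) : {poly F} :=
  if n is n1.+1 then
    if n1 is n2.+1 then
      n%:R^-1 *: ('X * meixner F n1 - n1%:R *: meixner F n2)
    else 'X
  else 1.

Definition H2_real (F : fieldType) (m : nat) : {poly F} :=
  'X * meixner F m.+1 - meixner F m.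

(** The total coefficient of [y q_{n-1}] is [- (4 n^2 + 18 n + 12)]. Its part [- (3 n^2 + 7 n + 6)]
    is absorbed into the first term, which then vanishes at the zeros of [H2_real]. *)
Definition H3_real (F : fieldType) (m : nat) : {poly F} :=
  let n := m.+1%:R in
  (3 * n ^+ 2 + 7 * n + 6) *: ('X * H2_real F m)
  - ((n + 1) * (9 * n + 14)) *: meixner F m.+1
  - (n ^+ 2 + 11 * n + 6) *: ('X * meixner F m).

Lemma horner_H2_real (F : fieldType) m (x : F) :
  (H2_real F m).[x] = x * (meixner F m.+1).[x] - (meixner F m).[x].
Proof. by rewrite !(hornerD, hornerN, hornerM, hornerX). Qed.

Lemma horner_H3_real (F : fieldType) m (x : F) (n := m.+1%:R) :
  (H3_real F m).[x] = (3 * n ^+ 2 + 7 * n + 6) * (x * (H2_real F m).[x])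
    - (n + 1) * (9 * n + 14) * (meixner F m.+1).[x]
    - (n ^+ 2 + 11 * n + 6) * (x * (meixner F m).[x]).
Proof. by rewrite !(hornerD, hornerN, hornerZ, hornerM, hornerX). Qed.

Lemma meixnerSS (F : fieldType) n :
  meixner F n.+2 = n.+2%:R^-1 *: ('X * meixner F n.+1 - n.+1%:R *: meixner F n).
Proof. by []. Qed.

Lemma meixnerSSE (F : realFieldType) n :
  meixner F n.+2 = n.+2%:R^-1 *: ('X * meixner F n.+1)
                   + (- (n.+2%:R^-1 * n.+1%:R)) *: meixner F n.
Proof. by rewrite meixnerSS scalerBr scalerA scaleNr. Qed.

Lemma size_meixner (F : realFieldType) n :
  size (meixner F n) = n.+1 /\ 0 < lead_coef (meixner F n).
Proof.
suff [] : (size (meixner F n) = n.+1 /\ 0 < lead_coef (meixner F n)) /\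
  (size (meixner F n.+1) = n.+2 /\ 0 < lead_coef (meixner F n.+1)) by [].
elim: n => [|n [[s0 l0] [s1 l1]]].
  by rewrite /= size_poly1 size_polyX lead_coef1 lead_coefX ltr01.
split=> //; rewrite meixnerSSE.
set h := (- _ *: _); have hs : (size h <= size (meixner F n.+1))%N.
  by rewrite (leq_trans (size_scale_leq _ _)) // s0 s1.
have := lead_scaleMXD (c := n.+2%:R^-1) _ l1 hs.
by rewrite s1 invr_gt0 ltr0n => /(_ isT).
Qed.

(** At a zero of [q_{n+1}] the recurrence makes [q_{n+2}] a negative multiple of [q_n]. *)
Lemma meixner_interlaced (F : rcfType) n :
  strictly_interlaced (meixner F n.+1) (meixner F n).
Proof.
elim: n => [|n IH].
  exists [:: 0], [::]; split=> //=; first by rewrite rootX eqxx.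
  by rewrite size_polyX size_poly1 lead_coefX lead_coef1.
have [s1 _] := size_meixner F n.+1; have [s2 l2] := size_meixner F n.+2.
apply: strictly_interlaced_step IH _ l2 _; first by rewrite s1 s2.
move=> x /rootP x1 x0; rewrite meixnerSS !hornerE x1 mulr0 add0r mulrN mulNr oppr_lt0.
rewrite -mulrA mulr_gt0 ?invr_gt0 ?ltr0n //.
by rewrite -mulrA mulr_gt0 ?ltr0n // -expr2 exprn_even_gt0.
Qed.

Lemma size_H2_real (F : realFieldType) m :
  size (H2_real F m) = m.+3 /\ 0 < lead_coef (H2_real F m).
Proof.
have [s0 _] := size_meixner F m; have [s1 l1] := size_meixner F m.+1.
rewrite /H2_real -[X in X - _]scale1r -s1.
by apply: lead_scaleMXD; rewrite ?ltr01 // size_polyN s0 s1.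
Qed.

Lemma size_H3_real (F : realFieldType) m :
  size (H3_real F m) = m.+4 /\ 0 < lead_coef (H3_real F m).
Proof.
have [s0 _] := size_meixner F m; have [s1 _] := size_meixner F m.+1.
have [s2 l2] := size_H2_real F m.
rewrite /H3_real -addrA -s2; apply: lead_scaleMXD => //.
rewrite s2 (leq_trans (size_polyD _ _)) // geq_max !size_polyN.
rewrite (leq_trans (size_scale_leq _ _)) ?s1 //=.
rewrite (leq_trans (size_scale_leq _ _)) // mulrC.
by rewrite (leq_trans (size_polyMleq _ _)) // s0 size_polyX addn2.
Qed.

Lemma H2_real_interlaced (F : rcfType) m :
  strictly_interlaced (H2_real F m) (meixner F m.+1).
Proof.
have [s1 _] := size_meixner F m.+1; have [s2 l2] := size_H2_real F m.
apply: strictly_interlaced_step (meixner_interlaced F m) _ l2 _.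
  by rewrite s1 s2.
move=> x /rootP x1 x0; rewrite horner_H2_real x1 mulr0 add0r mulNr oppr_lt0.
by rewrite -expr2 exprn_even_gt0.
Qed.

(** At a zero [x] of [H2_real] one has [q_m = x q_{m+1}], so [H3_real] takes the value [- ((n + 1)
    (9 n + 14) + (n^2 + 11 n + 6) x^2) q_{m+1}] with [n = m + 1]. *)
Lemma H3_real_interlaced (F : rcfType) m :
  strictly_interlaced (H3_real F m) (H2_real F m).
Proof.
have [s2 _] := size_H2_real F m; have [s3 l3] := size_H3_real F m.
apply: strictly_interlaced_step (H2_real_interlaced F m) _ l3 _.
  by rewrite s2 s3.
move=> x /rootP x2 x1; rewrite horner_H3_real x2.
move: x2; rewrite horner_H2_real => /eqP; rewrite subr_eq0 => /eqP <-.
set q := (meixner F m.+1).[x] in x1 *; set n : F := m.+1%:R.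
have n0 : 0 < n by rewrite ltr0n.
move: n q n0 x1 => n q n0 x1.
have c0 : 0 < (n + 1) * (9 * n + 14) by rewrite mulr_gt0 //; lra.
have c1 : 0 <= n ^+ 2 + 11 * n + 6 by rewrite !addr_ge0 ?exprn_ge0 ?mulr_ge0 // ltW.
have q0 : 0 < q ^+ 2 by rewrite exprn_even_gt0.
rewrite [X in X < 0](_ : _ =
  - (((n + 1) * (9 * n + 14) + (n ^+ 2 + 11 * n + 6) * x ^+ 2) * q ^+ 2)).
  rewrite oppr_lt0; apply: mulr_gt0 => //; apply: (ltr_pwDl c0).
  by apply: (mulr_ge0 c1); apply: sqr_ge0.
by ring.
Qed.

(** * Sums over integer points of l1-balls *)

Definition isum (V : nmodType) (s : nat) (g : int -> V) : V :=
  g 0 + \sum_(b < s) (g b.+1%:Z + g (- b.+1%:Z)).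

(* The sum of [f (z_1 + ... + z_n)] over the integer points [z] of the
   [l^1]-ball of radius [s]. *)
Fixpoint ball_sum (V : nmodType) (n s : nat) (f : int -> V) : V :=
  if n is n'.+1 then
    isum s (fun a => ball_sum n' (s - `|a|) (fun k => f (a + k)))
  else f 0.

Lemma ball_sumS (V : nmodType) n s (f : int -> V) :
  ball_sum n.+1 s f
  = isum s (fun a => ball_sum n (s - `|a|) (fun k => f (a + k))).
Proof. by []. Qed.

Lemma isumS (V : nmodType) s (g : int -> V) :
  isum s.+1 g = isum s g + (g s.+1%:Z + g (- s.+1%:Z)).
Proof. by rewrite /isum big_ord_recr /= addrA. Qed.

Lemma eq_isum (V : nmodType) s (g h : int -> V) :
  (forall a, (`|a| <= s)%N -> g a = h a) -> isum s g = isum s h.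
Proof.
move=> gh; rewrite /isum gh //; congr +%R; apply: eq_bigr => b _.
by rewrite !gh ?abszN ?absz_nat ?ltn_ord.
Qed.

Lemma isumD (V : nmodType) s (g h : int -> V) :
  isum s (fun a => g a + h a) = isum s g + isum s h.
Proof.
rewrite /isum addrACA -big_split /=; congr +%R; apply: eq_bigr => b _.
by rewrite addrACA.
Qed.

Lemma isumM (F : pzSemiRingType) s (c : F) (g : int -> F) :
  isum s (fun a => c * g a) = c * isum s g.
Proof.
rewrite /isum mulrDr big_distrr /=; congr +%R; apply: eq_bigr => b _.
by rewrite mulrDr.
Qed.

Lemma isumN (V : nmodType) s (g : int -> V) :
  isum s (fun a => g (- a)) = isum s g.
Proof.
rewrite /isum oppr0; congr +%R; apply: eq_bigr => b _.
by rewrite opprK addrC.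
Qed.

(** The slice of a ball at first coordinate [a] has radius [s - |a|]: radius [s] occurs once and
    every smaller radius twice. *)
Lemma isum_abs (V : nmodType) s (g : nat -> V) :
  isum s (fun a => g (s - `|a|)%N) = g s + (\sum_(b < s) g b) *+ 2.
Proof.
rewrite /isum absz0 subn0; congr +%R.
rewrite (reindex_inj rev_ord_inj) /= -sumrMnl; apply: eq_bigr => b _.
rewrite mulr2n.
by rewrite subnSK ?ltn_ord // subKn // ltnW.
Qed.

Lemma eq_ball_sum (V : nmodType) n s (f g : int -> V) :
  (forall k, (`|k| <= s)%N -> f k = g k) -> ball_sum n s f = ball_sum n s g.
Proof.
elim: n s f g => [|n IH] s f g fg /=; first by rewrite fg.
apply: eq_isum => a la; apply: IH => k lk; apply: fg; lia.
Qed.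

Lemma ball_sumD (V : nmodType) n s (f g : int -> V) :
  ball_sum n s (fun k => f k + g k) = ball_sum n s f + ball_sum n s g.
Proof.
elim: n s f g => [//|n IH] s f g /=.
by rewrite -isumD; apply: eq_isum => a _; rewrite IH.
Qed.

Lemma ball_sumM (F : pzSemiRingType) n s (c : F) (f : int -> F) :
  ball_sum n s (fun k => c * f k) = c * ball_sum n s f.
Proof.
elim: n s f => [//|n IH] s f /=.
by rewrite -isumM; apply: eq_isum => a _; rewrite IH.
Qed.

Lemma ball_sumN (V : nmodType) n s (f : int -> V) :
  ball_sum n s (fun k => f (- k)) = ball_sum n s f.
Proof.
elim: n s f => [|n IH] s f /=; first by rewrite oppr0.
rewrite -isumN; apply: eq_isum => a _; rewrite abszN -IH.
by apply: eq_ball_sum => k _; rewrite opprD !opprK.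
Qed.

(** The ball is symmetric under negation, so the sum equals its own opposite. *)
Lemma ball_sum_id (F : numFieldType) n s :
  ball_sum n s (fun k => k%:~R) = 0 :> F.
Proof.
have h : ball_sum n s (fun k => k%:~R : F) = - ball_sum n s (fun k => k%:~R : F).
  rewrite -[LHS]ball_sumN -mulN1r -ball_sumM; apply: eq_ball_sum => k _.
  by rewrite mulrNz mulN1r.
by apply/eqP; move/eqP: h; rewrite -addr_eq0 -mulr2n mulrn_eq0.
Qed.

(** * Cross-polytope counts and moments of the coordinate sum *)

(* The Ehrhart polynomial of the [n]-dimensional cross-polytope at
   [(w - 1) / 2]. *)
Fixpoint cross (F : fieldType) (w : F) (n : nat) : F :=
  if n is n1.+1 then
    if n1 is n2.+1 then (w * cross w n1 + n1%:R * cross w n2) / n%:R else w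
  else 1.

Lemma crossSS (F : numFieldType) (w : F) n :
  n.+2%:R * cross w n.+2 = w * cross w n.+1 + n.+1%:R * cross w n.
Proof. by rewrite mulrC /= divfK // pnatr_eq0. Qed.

Lemma cross1 (F : numFieldType) n : cross (1 : F) n = 1.
Proof.
suff [] : cross (1 : F) n = 1 /\ cross (1 : F) n.+1 = 1 by [].
elim: n => [//|n [c0 c1]]; split=> //.
apply: (mulfI (x := n.+2%:R)); first by rewrite pnatr_eq0.
by rewrite crossSS c0 c1; rewrite -!natr1; ring.
Qed.

(** With [w = 2 s + 1], the generating function of [cross w n] in [n] is
    [(1 + t)^s / (1 - t)^(s + 1)]; raising [s] by one multiplies it by [(1 + t) / (1 - t)]. The
    proof is an induction on the recurrence, valid for every [w]. *)
Lemma cross_diff (F : numFieldType) (w : F) n :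
  cross (w + 2) n.+1 = cross w n.+1 + cross (w + 2) n + cross w n.
Proof.
suff [] : cross (w + 2) n.+1 = cross w n.+1 + cross (w + 2) n + cross w n /\
  cross (w + 2) n.+2 = cross w n.+2 + cross (w + 2) n.+1 + cross w n.+1 by [].
elim: n => [|n [h0 h1]].
  by split; rewrite /=; [ring|field; rewrite ?pnatr_eq0].
split=> //; apply: (mulfI (x := n.+3%:R)); first by rewrite pnatr_eq0.
rewrite !mulrDr !crossSS.
have e0 := crossSS w n; have e0' := crossSS (w + 2) n.
move: h0 h1 e0 e0'; rewrite -!natr1.
move: (cross _ n.+2) (cross _ n.+2) (cross _ n.+1) (cross _ n.+1) (cross _ n)
  (cross _ n) (n%:R : F) => c2' c2 c1' c1 c0' c0 x h0 h1 e0 e0'.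
have c0E : c0 = c1 - c1' - c0' by rewrite h0; ring.
rewrite h1 c0E in e0' *; apply/eqP; rewrite -subr_eq0.
(* Primed variables belong to [w], unprimed ones to [w + 2]. The difference of the two sides is the
   sum of the defects of the recurrence at these two arguments. *)
apply/eqP; transitivity ((w * c1' + (x + 1) * c0' - (x + 1 + 1) * c2')
  + ((w + (0 + 1 + 1)) * c1 + (x + 1) * (c1 - c1' - c0')
     - (x + 1 + 1) * (c2' + c1 + c1'))); first by ring.
by rewrite -e0 -e0' !subrr addr0.
Qed.

Arguments cross F w n : simpl never.

(** By [cross_diff], [cross w n.+1 - cross w n] grows by [2 * cross w n] when [w] grows by 2, so the
    sum telescopes. *)
Lemma sum_cross (F : numFieldType) n s :
  \sum_(b < s) cross (2 * b%:R + 1 : F) n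
  = (cross (2 * s%:R + 1) n.+1 - cross (2 * s%:R + 1) n) / 2.
Proof.
elim: s => [|s IH]; first by rewrite big_ord0 mulr0 add0r !cross1 subrr mul0r.
rewrite big_ord_recr /= IH (_ : 2 * s.+1%:R + 1 = 2 * s%:R + 1 + 2).
  by rewrite cross_diff; field.
by rewrite -natr1; ring.
Qed.

(** Raising [s] by one replaces the weight [s - b] by [(s - b) + 1], which adds an instance of
    [sum_cross]. The quadratic weight below is treated in the same way. *)
Lemma sum_cross1 (F : numFieldType) n s :
  \sum_(b < s) (s%:R - b%:R) * cross (2 * b%:R + 1 : F) n
  = (cross (2 * s%:R + 1) n.+2 - cross (2 * s%:R + 1) n) / 4.
Proof.
elim: s => [|s IH]; first by rewrite big_ord0 mulr0 add0r !cross1 subrr mul0r.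
rewrite big_ord_recr /=.
under eq_bigr => b _ do rewrite -natr1 addrAC mulrDl mul1r.
rewrite big_split /= IH sum_cross (_ : 2 * s.+1%:R + 1 = 2 * s%:R + 1 + 2).
  by rewrite !cross_diff -natr1; field.
by rewrite -natr1; ring.
Qed.

Lemma sum_cross2 (F : numFieldType) n s :
  \sum_(b < s) (s%:R - b%:R) ^+ 2 * cross (2 * b%:R + 1 : F) n
  = (cross (2 * s%:R + 1) n.+3 - cross (2 * s%:R + 1) n.+1) / 4.
Proof.
elim: s => [|s IH]; first by rewrite big_ord0 mulr0 add0r !cross1 subrr mul0r.
rewrite big_ord_recr /=.
rewrite (eq_bigr (fun b : 'I_s => (s%:R - b%:R) ^+ 2 * cross (2 * b%:R + 1) n
    + 2 * ((s%:R - b%:R) * cross (2 * b%:R + 1) n) + cross (2 * b%:R + 1) n)).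
  rewrite !big_split /= -big_distrr /= IH sum_cross1 sum_cross.
  rewrite (_ : 2 * s.+1%:R + 1 = 2 * s%:R + 1 + 2).
    by rewrite !cross_diff -natr1; field.
  by rewrite -natr1; ring.
by move=> b _; rewrite -natr1; ring.
Qed.

Lemma ball_sum1 (F : numFieldType) n s :
  ball_sum n s (fun=> 1) = cross (2 * s%:R + 1 : F) n.
Proof.
elim: n s => [//|n IH] s /=.
under eq_isum => a _ do rewrite IH.
rewrite (isum_abs s (fun r => cross (2 * r%:R + 1) n)) sum_cross.
by rewrite -mulr_natr; field.
Qed.

Lemma odd_abszD (a b : int) : odd `|(a + b)%R| = odd `|a| (+) odd `|b|.
Proof. by lia. Qed.

(** Slicing preserves the condition: [a + k] and [s] have equal parity exactly when [k] and
    [s - |a|] do. The induction starts in dimension 1. *)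
Lemma ball_sum_parity (F : numFieldType) n s :
  ball_sum n.+1 s (fun k => (odd `|k| == odd s)%:R)
  = (cross (2 * s%:R + 1 : F) n.+1 + cross (2 * s%:R + 1) n) / 2.
Proof.
elim: n s => [|n IH] s.
  rewrite /=.
  rewrite (@eq_isum _ _ _ (fun a => (~~ odd (s - `|a|))%:R)); last first.
    by move=> a al; rewrite addr0 oddB //; do 2 case: odd.
  rewrite (isum_abs s (fun r => (~~ odd r)%:R)).
  have -> : (\sum_(b < s) (~~ odd b)%:R) *+ 2 = s%:R + (odd s)%:R :> F.
    elim: s => [|s IH]; first by rewrite big_ord0 mul0rn addr0.
    rewrite big_ord_recr /= mulrnDl IH -natr1.
    by case: odd => /=; ring.
  by rewrite /cross; case: odd => /=; field.
rewrite ball_sumS.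
rewrite (@eq_isum _ _ _ (fun a => (cross (2 * (s - `|a|)%:R + 1 : F) n.+1
    + cross (2 * (s - `|a|)%:R + 1) n) / 2)); last first.
  move=> a al; rewrite -IH; apply: eq_ball_sum => k _; congr (_%:R).
  rewrite oddB // odd_abszD.
  by do 3 case: odd.
rewrite (isum_abs s (fun r => (cross (2 * r%:R + 1) n.+1
    + cross (2 * r%:R + 1) n) / 2)).
by rewrite -big_distrl /= big_split /= !sum_cross; field.
Qed.

Lemma sqr_intr_abs (F : pzRingType) (a : int) :
  a%:~R ^+ 2 = `|a|%:R ^+ 2 :> F.
Proof. by case: a => m //; rewrite NegzE abszN mulrNz sqrrN. Qed.

Lemma ball_sum_sq (F : numFieldType) n s :
  ball_sum n s (fun k => k%:~R ^+ 2)
  = n%:R / 2 * (cross (2 * s%:R + 1 : F) n.+2 - cross (2 * s%:R + 1) n).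
Proof.
elim: n s => [|n IH] s; first by rewrite /= mul0r mul0r expr0n.
rewrite ball_sumS.
rewrite (@eq_isum _ _ _ (fun a => `|a|%:R ^+ 2 * cross (2 * (s - `|a|)%:R + 1 : F) n
    + n%:R / 2 * (cross (2 * (s - `|a|)%:R + 1) n.+2
                  - cross (2 * (s - `|a|)%:R + 1) n))); last first.
  move=> a al; rewrite -IH -ball_sum1.
  (* The added zero is [2 a] times the sum of [k] over the slice: the cross term in the expansion of
     [(a + k)^2]. *)
  rewrite -[RHS]addr0 -[X in _ = _ + X](mulr0 (2 * a%:~R)).
  rewrite -(ball_sum_id F n (s - `|a|)) -!ball_sumM -!ball_sumD.
  apply: eq_ball_sum => k _; rewrite mulr1 -sqr_intr_abs intrD; ring.
rewrite isumD isumM (isum_abs s (fun r => cross (2 * r%:R + 1) n.+2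
    - cross (2 * r%:R + 1) n)).
have -> : isum s (fun a => `|a|%:R ^+ 2 * cross (2 * (s - `|a|)%:R + 1 : F) n)
    = (\sum_(b < s) (s%:R - b%:R) ^+ 2 * cross (2 * b%:R + 1) n) *+ 2.
  rewrite (@eq_isum _ _ _ (fun a => (s%:R - (s - `|a|)%:R) ^+ 2
    * cross (2 * (s - `|a|)%:R + 1 : F) n)); last first.
    by move=> a al; rewrite natrB // subKr.
  rewrite (isum_abs s (fun r => (s%:R - r%:R) ^+ 2 * cross (2 * r%:R + 1) n)).
  by rewrite subrr expr0n mul0r add0r.
by rewrite big_split /= sumrN !sum_cross sum_cross2 -natr1; field.
Qed.

(** * Points of prescribed coordinate sum in dimensions 1 to 3 *)

Lemma ball_sum1_eq (F : pzSemiRingType) s (k : int) :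
  ball_sum 1 s (fun j => (j + k == 0)%:R) = (`|k| <= s)%N%:R :> F.
Proof.
rewrite ball_sumS /=; elim: s => [|s IH].
  by rewrite /isum big_ord0 !addr0 add0r leqn0 absz_eq0.
rewrite isumS IH -!natrD; congr (_%:R).
by case: eqP; case: eqP; case: leqP; case: leqP => /=; lia.
Qed.

(* The integers [a] with [|a| + |a + k| <= s] form the interval [- v, u], where
   [u] and [v] are the integer parts of [(s - k) / 2] and [(s + k) / 2]. *)
Lemma isum_interval (F : pzSemiRingType) s u v (k : int) (G : nat -> F) :
  (`|k| <= s)%N -> (s%:Z - k - 1 <= 2 * u%:Z <= s%:Z - k) ->
  (s%:Z + k - 1 <= 2 * v%:Z <= s%:Z + k) ->
  isum s (fun a => (`|(a + k)%R| <= s - `|a|)%N%:R * G (absz a))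
  = G 0%N + \sum_(b < u) G b.+1 + \sum_(b < v) G b.+1.
Proof.
move=> ks hu hv; rewrite /isum add0r subn0 ks mul1r -addrA; congr +%R.
rewrite big_split /= (big_ord_widen s (fun b => G b.+1)); last by lia.
rewrite (big_ord_widen s (fun b => G b.+1) (n1 := v)); last by lia.
congr +%R; rewrite [RHS]big_mkcond; apply: eq_bigr => b _.
  have -> : (`|(b.+1%:Z + k)%R| <= s - b.+1)%N = (b < u)%N.
    by have := ltn_ord b; lia.
  by case: ifP; rewrite ?mul1r ?mul0r.
have -> : (`|(- b.+1%:Z + k)%R| <= s - `|(- b.+1%:Z)%R|)%N = (b < v)%N.
  by have := ltn_ord b; lia.
by case: ifP; rewrite ?mul1r ?mul0r.
Qed.

(** The first coordinate [a] determines the second, [- (a + k)], so the count is the length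
    [u + v + 1] of the interval of [isum_interval]. *)
Lemma ball_sum2_eq (F : pzSemiRingType) s (k : int) :
  ball_sum 2 s (fun j => (j + k == 0)%:R)
  = ((`|k| <= s) * (s + (odd `|k| == odd s)))%N%:R :> F.
Proof.
rewrite ball_sumS (@eq_isum _ _ _ (fun a => (`|(a + k)%R| <= s - `|a|)%N%:R * 1));
  last first.
  move=> a _; rewrite mulr1 -ball_sum1_eq.
  by apply: eq_ball_sum => j _; rewrite addrA [a + j]addrC.
have [ks|ks] := leqP `|k| s; last first.
  rewrite mul0n (@eq_isum _ _ _ (fun=> 0)); last first.
    by move=> a al; rewrite mulr1; case: leqP => //; lia.
  by rewrite /isum big1 ?addr0 // => b _; rewrite addr0.
rewrite (isum_interval (u := (`|s%:Z - k|./2)) (v := (`|s%:Z + k|./2))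
  (fun=> 1) ks); [|lia|lia].
rewrite /= !sumr_const !card_ord -mulrS -natrD mul1n; congr (_%:R).
by lia.
Qed.

Lemma sum_arith (F : numFieldType) (N : F) u :
  \sum_(b < u) (N + 1 - b.+1%:R) = u%:R * N - u%:R * (u%:R - 1) / 2.
Proof.
elim: u => [|u IH]; first by rewrite big_ord0 !mul0r subrr.
by rewrite big_ord_recr /= IH -natr1; field.
Qed.

(** The parity bit of [ball_sum2_eq] is the same in all slices, so a nonempty slice has
    [u + v + 1 - |a|] points. This leaves two arithmetic sums, and [v - u = k]. *)
Lemma ball_sum3_eq (F : numFieldType) s (k : int) : (`|k| <= s)%N ->
  ball_sum 3 s (fun j => (j + k == 0)%:R)
  = (3 * (s%:R + (odd `|k| == odd s)%:R) ^+ 2 + 1 - k%:~R ^+ 2) / 4 :> F.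
Proof.
move=> ks; pose u := `|s%:Z - k|./2; pose v := `|s%:Z + k|./2.
have uvE : (s + (odd `|k| == odd s) = u + v + 1)%N by rewrite /u /v; lia.
rewrite ball_sumS (@eq_isum _ _ _ (fun a => (`|(a + k)%R| <= s - `|a|)%N%:R
    * ((u + v)%:R + 1 - `|a|%:R))); last first.
  move=> a al.
  transitivity (ball_sum 2 (s - `|a|) (fun j => (j + (a + k) == 0)%:R) : F).
    by apply: eq_ball_sum => j _; rewrite addrA [a + j]addrC.
  rewrite ball_sum2_eq natrM; case: leqP => [le|_]; last by rewrite !mul0r.
  rewrite !mul1r natr1 -addn1 -uvE -natrB; last by lia.
  rewrite -addnBAC // oddB //; congr (_ + nat_of_bool _)%:R.
  rewrite odd_abszD; by do 3 case: odd.
rewrite (isum_interval (u := u) (v := v)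
  (fun i => (u + v)%:R + 1 - i%:R) ks); [|rewrite /u; lia|rewrite /v; lia].
have kE : k%:~R = v%:R - u%:R :> F.
  by rewrite !pmulrn -intrB; congr (_%:~R); rewrite /u /v; lia.
rewrite !sum_arith -natrD uvE kE !natrD.
by field.
Qed.

Lemma ball_sum_H2 (F : numFieldType) m s (w : F := 2 * s%:R + 1) :
  ball_sum m.+1 s (fun k => ball_sum 2 s (fun j => (j + k == 0)%:R))
  = (w * cross w m.+1 + cross w m) / 2.
Proof.
rewrite (@eq_ball_sum _ _ _ _ (fun k => s%:R * 1 + (odd `|k| == odd s)%:R)).
  by rewrite ball_sumD ball_sumM ball_sum1 ball_sum_parity /w; field.
by move=> k ks; rewrite ball_sum2_eq ks mul1n natrD mulr1.
Qed.

Lemma ball_sum_H3 (F : numFieldType) m s (w : F := 2 * s%:R + 1)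
    (n : F := m.+1%:R) :
  ball_sum m.+1 s (fun k => ball_sum 3 s (fun j => (j + k == 0)%:R))
  = ((3 * n ^+ 2 + 7 * n + 6) * (w ^+ 2 * cross w m.+1)
     + (4 * n ^+ 2 + 18 * n + 12) * (w * cross w m)
     + (n + 1) * (9 * n + 14) * cross w m.+1) / (16 * (n + 1) * (n + 2)).
Proof.
have n1 : n + 1 != 0 by rewrite /n natr1 pnatr_eq0.
have n2 : n + 2 != 0 by rewrite /n -natrD addn2 pnatr_eq0.
(* [ball_sum_sq] produces [cross w m.+3]; the recurrence brings it down to [cross w m.+1] and
   [cross w m]. *)
have E3 : cross w m.+3 = (w * cross w m.+2 + (n + 1) * cross w m.+1) / (n + 2).
  by rewrite /n natr1 -natrD addn2.
have E2 : cross w m.+2 = (w * cross w m.+1 + n * cross w m) / (n + 1).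
  by rewrite /n natr1.
(* Since [e] is 0 or 1, [3 (s + e)^2 = 3 s^2 + 3 (2 s + 1) e]. *)
rewrite (@eq_ball_sum _ _ _ _ (fun k => (3 * s%:R ^+ 2 + 1) / 4 * 1
  + (3 * (2 * s%:R + 1) / 4 * (odd `|k| == odd s)%:R
     + - 4^-1 * k%:~R ^+ 2))); last first.
  move=> k ks; rewrite ball_sum3_eq //.
  by case: (_ == _) => /=; field.
rewrite !ball_sumD !ball_sumM ball_sum1 ball_sum_parity ball_sum_sq -/w -/n E3 E2.
move: (cross w m.+1) (cross w m) => c1 c0; rewrite /w; field.
by rewrite !nat1r n1 n2.
Qed.

(** * Ball sums as sums over a finite type *)

Definition centered (M : nat) (i : 'I_(M.*2.+1)) : int := i%:Z - M%:Z.

Lemma sum_centered (V : nmodType) M (g : int -> V) :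
  \sum_(i : 'I_(M.*2.+1)) g (centered i) = isum M g.
Proof.
rewrite /centered; elim: M g => [|M IH] g.
  by rewrite big_ord_recl big_ord0 /isum big_ord0 subrr.
rewrite isumS -IH doubleS big_ord_recr big_ord_recl /=.
rewrite [X in X + _ = _]addrC -addrA; congr (_ + _).
  by apply: eq_bigr => i _; congr g; rewrite /bump /=; lia.
by rewrite addrC; congr (g _ + g _); lia.
Qed.

Lemma sum_centered_ball (V : nmodType) M s (g : int -> V) : (s <= M)%N ->
  \sum_(i : 'I_(M.*2.+1) | (`|centered i| <= s)%N) g (centered i) = isum s g.
Proof.
move=> sM; rewrite big_mkcond /=.
rewrite (sum_centered M (fun a => if (`|a| <= s)%N then g a else 0)).
rewrite /isum; congr (_ + _); rewrite [RHS](big_ord_widen _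
  (fun b => g b.+1%:Z + g (- b.+1%:Z)) sM) [RHS]big_mkcond.
apply: eq_bigr => b _ /=.
by case: ifP; rewrite ?addr0.
Qed.

Definition ffcons (T : finType) n (p : T * {ffun 'I_n -> T}) : {ffun 'I_n.+1 -> T} :=
  [ffun i => if unlift ord0 i is Some j then p.2 j else p.1].

Lemma ffcons0 (T : finType) n (p : T * {ffun 'I_n -> T}) : ffcons p ord0 = p.1.
Proof. by rewrite ffunE unlift_none. Qed.

Lemma ffconsS (T : finType) n (p : T * {ffun 'I_n -> T}) i :
  ffcons p (lift ord0 i) = p.2 i.
Proof. by rewrite ffunE liftK. Qed.

Lemma ffcons_bij (T : finType) n : bijective (@ffcons T n).
Proof.
exists (fun z : {ffun 'I_n.+1 -> T} => (z ord0, [ffun i => z (lift ord0 i)])).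
  by move=> [a z]; rewrite ffcons0; congr pair; apply/ffunP => i; rewrite ffunE ffconsS.
move=> z; apply/ffunP => i; case: (unliftP ord0 i) => [j|] ->.
  by rewrite ffconsS ffunE.
by rewrite ffcons0.
Qed.

Definition norm1 n M (z : {ffun 'I_n -> 'I_(M.*2.+1)}) : nat :=
  (\sum_i `|centered (z i)|)%N.

Definition total n M (z : {ffun 'I_n -> 'I_(M.*2.+1)}) : int :=
  \sum_i centered (z i).

(** The box size [M] is kept apart from the radius [s] because the induction shrinks the radius
    while the type of the coordinates stays fixed. *)
Lemma ball_sum_ffun (V : nmodType) n M s (f : int -> V) : (s <= M)%N ->
  \sum_(z : {ffun 'I_n -> 'I_(M.*2.+1)} | (norm1 z <= s)%N) f (total z)
  = ball_sum n s f.
Proof.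
elim: n s f => [|n IH] s f sM.
  have z0 : {ffun 'I_0 -> 'I_(M.*2.+1)} by apply: finfun; case.
  rewrite (big_pred1 z0) /total ?big_ord0 // => z.
  by rewrite /norm1 big_ord0 leq0n; apply/esym/eqP/ffunP; case.
rewrite ball_sumS (reindex _ (onW_bij _ (@ffcons_bij _ n))) /=.
rewrite -(sum_centered_ball _ sM).
rewrite [RHS](eq_bigr (fun a =>
  \sum_(z : {ffun 'I_n -> 'I_(M.*2.+1)} | (norm1 z <= s - `|centered a|)%N)
    f (centered a + total z))); last first.
  move=> a _; rewrite (IH _ (fun k => f (centered a + k))) //.
  exact: leq_trans (leq_subr _ _) sM.
rewrite pair_big_dep /=; apply: eq_big => [[a z]|[a z] _] /=.
  rewrite /norm1 big_ord_recl ffcons0 /=.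
  under eq_bigr => i _ do rewrite ffconsS.
  by move: (\sum_(i < n) _)%N (absz _) => x y; lia.
rewrite /total big_ord_recl ffcons0 /=.
by under eq_bigr => i _ do rewrite ffconsS.
Qed.

(** * Lattice points of the dilated edge polytope *)

Lemma odd_sum_absz (I : finType) (y : I -> int) :
  odd (\sum_i `|y i|)%N = odd `|(\sum_i y i)%R|.
Proof.
apply: (big_ind2 (fun (m : nat) (k : int) => odd m = odd `|k|)) => //.
by move=> m k m' k' e e'; rewrite oddD e e' odd_abszD.
Qed.

Lemma PoszD_sum (I : finType) (y : I -> nat) :
  (\sum_i y i)%N%:Z = \sum_i (y i)%:Z.
Proof. by apply: (big_morph Posz PoszD). Qed.

Lemma sum_absz_upd (I : finType) (y : I -> int) (i : I) (e : int) :
  (\sum_k `|(y k + (k == i)%:Z * e)%R| + `|y i| = \sum_k `|y k| + `|(y i + e)%R|)%N.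
Proof.
rewrite (bigD1 i) //= [in RHS](bigD1 i) //= eqxx mul1r.
rewrite (eq_bigr (fun k => absz (y k))); first by lia.
by move=> k /negbTE ->; rewrite mul0r addr0.
Qed.

(* Peeling off one edge: a balanced integer point in the product of two
   [l^1]-balls of radius [s + 1] is moved into radius [s] by subtracting
   [e] times an edge vector. *)
Lemma peel_edge (I J : finType) (y : I -> int) (z : J -> int) s (i0 : I) (j0 : J) :
  \sum_i y i + \sum_j z j = 0 ->
  (\sum_i `|y i| <= s.+1)%N -> (\sum_j `|z j| <= s.+1)%N ->
  exists e i j, [/\ (`|e| <= 1)%N, (\sum_k `|(y k + (k == i)%:Z * e)%R| <= s)%N
    & (\sum_k `|(z k + (k == j)%:Z * - e)%R| <= s)%N].
Proof.
(* Exchanging the two sides replaces [e] by [- e]. *)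
wlog le_zy : I J y z i0 j0 / (\sum_j `|z j| <= \sum_i `|y i|)%N => [hw|].
  case: (leqP (\sum_j `|z j|)%N (\sum_i `|y i|)%N) => [/hw h|/ltnW /hw h].
    exact: h.
  rewrite addrC => h0 hy hz; have [e [j [i [e1 h1 h2]]]] := h j0 i0 h0 hz hy.
  by exists (- e), i, j; split; rewrite ?abszN ?opprK.
move=> yz0 ys zs.
have [ys'|ys'] := leqP (\sum_i `|y i|)%N s.
  exists 0, i0, j0; split=> //.
    by under eq_bigr => k _ do rewrite mulr0 addr0.
  under eq_bigr => k _ do rewrite oppr0 mulr0 addr0.
  exact: leq_trans le_zy ys'.
have yE : (\sum_i `|y i| = s.+1)%N by lia.
have [i yi] : exists i, y i != 0.
  apply/existsP; apply: contraTT isT => /existsPn h.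
  by rewrite big1 // in yE => i _; apply/eqP; rewrite absz_eq0 -[_ == _]negbK h.
have par : odd (\sum_i `|y i|)%N = odd (\sum_j `|z j|)%N.
  by rewrite !odd_sum_absz; move/eqP: yz0; rewrite addr_eq0 => /eqP ->; rewrite abszN.
have yup := sum_absz_upd y i (- sgz (y i)).
(* Here the norm of [z] may grow by one, so any [j] will do. *)
have [zs'|zs'] := ltnP (\sum_j `|z j|)%N s.
  exists (- sgz (y i)), i, j0.
  have zup := sum_absz_upd z j0 (- - sgz (y i)).
  by split; move: yup zup yi; case: sgzP; lia.
(* Norm [s] is excluded by parity. *)
have zE : (\sum_j `|z j| = s.+1)%N by move: par; rewrite yE; lia.
case: (pselect (exists j, sgz (y i) * z j < 0)) => [[j zj]|nz].
  exists (- sgz (y i)), i, j.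
  have zup := sum_absz_upd z j (- - sgz (y i)).
  by split; move: yup zup yi zj; case: sgzP; lia.
(* No [z j] has the sign opposite to [e = sgz (y i)], so [e] times the sum of [y] is [- (s + 1)].
   This forces [e * y k = - |y k|] for all [k], which fails at [k = i]. *)
have zge j : 0 <= sgz (y i) * z j.
  by rewrite leNgt; apply/negP => zj; apply: nz; exists j.
pose e := sgz (y i).
have ez : e * \sum_j z j = s.+1%:Z.
  rewrite -zE mulr_sumr PoszD_sum; apply: eq_bigr => j _.
  by have := zge j; rewrite /e; move: yi; case: sgzP; lia.
have h0 : \sum_k (`|y k|%N%:Z + e * y k) = 0.
  rewrite big_split /= -mulr_sumr -PoszD_sum yE.
  by move/eqP: yz0; rewrite addr_eq0 => /eqP ->; rewrite mulrN ez subrr.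
have /(_ i isT) : forall k, true -> `|y k|%N%:Z + e * y k = 0.
  apply: psumr_eq0P h0 => k _.
  by rewrite /e; case: sgzP; lia.
by rewrite /e; move: yi; case: sgzP; lia.
Qed.

Lemma sum_delta (A : pzSemiRingType) (I : finType) (k : I) :
  \sum_l (l == k)%:R = 1 :> A.
Proof. by rewrite (bigD1 k) //= eqxx big1 ?addr0 // => l /negbTE ->. Qed.

Definition bip_point (R : realType) a n (y : 'I_a -> int) (z : 'I_n -> int)
    : {ffun vertex (Kbip a n) -> R^o} :=
  [ffun u : vertex (Kbip a n) =>
    (match u with inl i => y i | inr j => z j end)%:~R : R^o].

Lemma edge_polytope_conv (R : realType) (G : sgraph) (c : R) x y :
  0 <= c <= 1 -> edge_polytope x -> edge_polytope y ->
  @edge_polytope R G (c *: x + (1 - c) *: y).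
Proof.
move=> /andP[c0 c1] Px Py A [cA gA].
have := cA x y (Itv01 c0 c1); rewrite !inE.
by apply; [apply: Px|apply: Py].
Qed.

Lemma edge_polytope_gen (R : realType) (G : sgraph) (u v : vertex G) :
  adj u v -> @edge_polytope R G (basis_vec R u - basis_vec R v).
Proof. by move=> uv A [_ gA]; apply: gA; exists u, v. Qed.

(** The origin is the midpoint of an edge vector and its opposite. *)
Lemma edge_polytope0 (R : realType) (G : sgraph) (u v : vertex G) :
  adj u v -> @edge_polytope R G 0.
Proof.
move=> uv; have vu : adj v u by rewrite adj_sym.
have h := edge_polytope_conv (c := 2^-1) _ (@edge_polytope_gen R _ _ _ uv)
  (@edge_polytope_gen R _ _ _ vu).
rewrite (_ : 0 = 2^-1 *: (basis_vec R u - basis_vec R v)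
  + (1 - 2^-1) *: (basis_vec R v - basis_vec R u)).
  by apply: h; lra.
rewrite -opprB scalerN; have -> : 1 - 2^-1 = 2^-1 :> R by field.
by rewrite addNr.
Qed.

Lemma edge_polytope_dilateS (R : realType) (G : sgraph) s x g :
  edge_polytope x -> edge_polytope g ->
  [set s.+1%:R *: x | x in @edge_polytope R G] (s%:R *: x + g).
Proof.
move=> Px Pg; have s0 : s.+1%:R != 0 :> R by rewrite pnatr_eq0.
exists ((s%:R / s.+1%:R) *: x + (1 - s%:R / s.+1%:R) *: g).
  apply: edge_polytope_conv => //; rewrite divr_ge0 // ler_pdivrMr ?ltr0Sn //.
  by rewrite mul1r ler_nat leqnSn.
rewrite scalerDr !scalerA mulrBr mulrCA divff // !mulr1.
by rewrite -natr1 addrAC subrr add0r scale1r.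
Qed.

Lemma bip_edge_polytope (R : realType) a n (i : 'I_a) (j : 'I_n) (e : int) :
  (`|e| <= 1)%N ->
  @edge_polytope R (Kbip a n)
    (bip_point R (fun k => (k == i)%:Z * e) (fun k => (k == j)%:Z * - e)).
Proof.
move=> e1.
have /or3P[] : [|| e == 0, e == 1 | e == -1] by lia.
- move=> /eqP ->; rewrite (_ : bip_point _ _ _ = 0).
    by apply: (@edge_polytope0 R (Kbip a n) (inl i) (inr j)).
  by apply/ffunP => -[k|k]; rewrite !ffunE ?oppr0 mulr0.
- move=> /eqP ->; rewrite (_ : bip_point _ _ _ = basis_vec R (inl i : vertex (Kbip a n))
     - basis_vec R (inr j : vertex (Kbip a n))).
    exact: edge_polytope_gen.
  apply/ffunP => -[k|k]; rewrite !ffunE /= ?subr0 ?sub0r ?mulr1 ?mulrN1 //.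
  by rewrite mulrNz.
- move=> /eqP ->; rewrite (_ : bip_point _ _ _ = basis_vec R (inr j : vertex (Kbip a n))
     - basis_vec R (inl i : vertex (Kbip a n))).
    exact: edge_polytope_gen.
  apply/ffunP => -[k|k]; rewrite !ffunE /= ?subr0 ?sub0r ?opprK ?mulr1 ?mulrN1 //.
  by rewrite mulrNz.
Qed.

(** Each use of [peel_edge] lowers [s] by one, and [edge_polytope_dilateS] puts the removed vector
    back. *)
Lemma bip_point_dilate (R : realType) a n s (y : 'I_a.+1 -> int) (z : 'I_n.+1 -> int) :
  \sum_i y i + \sum_j z j = 0 ->
  (\sum_i `|y i| <= s)%N -> (\sum_j `|z j| <= s)%N ->
  [set s%:R *: x | x in @edge_polytope R (Kbip a.+1 n.+1)] (bip_point R y z).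
Proof.
elim: s y z => [|s IH] y z yz ys zs.
  exists 0; first by apply: (@edge_polytope0 R (Kbip a.+1 n.+1) (inl ord0) (inr ord0)).
  rewrite scaler0; apply/ffunP => -[k|k]; rewrite !ffunE.
    by move: ys; rewrite (bigD1 k) //= leqn0 addn_eq0 absz_eq0 => /andP[/eqP -> _].
  by move: zs; rewrite (bigD1 k) //= leqn0 addn_eq0 absz_eq0 => /andP[/eqP -> _].
have [e [i [j [e1 ys' zs']]]] := peel_edge ord0 ord0 yz ys zs.
have [|x Px xE] := IH _ _ _ ys' zs'.
  rewrite !big_split /= -!mulr_suml.
  have sumZ m (k : 'I_m) : \sum_l (l == k)%:Z = 1.
    by rewrite -[RHS](sum_delta int k); apply: eq_bigr => l _; rewrite natz.
  by rewrite !sumZ !mul1r addrACA yz subrr addr0.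
have := edge_polytope_dilateS s Px (@bip_edge_polytope R a.+1 n.+1 i j (- e) _).
rewrite abszN => /(_ e1); congr (_ _).
rewrite xE; apply/ffunP => -[k|k]; rewrite !ffunE /= -intrD; congr (_%:~R); ring.
Qed.

(** These conditions define a convex set containing all edge vectors, hence containing their convex
    hull. *)
Lemma polytope_bound (R : realType) a n x : @edge_polytope R (Kbip a n) x ->
  [/\ \sum_u x u = 0, \sum_i `|x (inl i)| <= 1 & \sum_j `|x (inr j)| <= 1].
Proof.
move=> Px.
pose A : set {ffun vertex (Kbip a n) -> R^o} := [set x : {ffun _ -> R^o} |
  [/\ \sum_u x u = 0, \sum_i `|x (inl i)| <= 1 & \sum_j `|x (inr j)| <= 1]].
suff : A x by [].
apply: Px; split.
  move=> {}x y l; rewrite !inE => -[x0 xl xr] [y0 yl yr].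
  have l0 : 0 <= l%:num by [].
  have l1 : 0 <= 1 - l%:num by rewrite subr_ge0.
  have bnd (I : finType) (f : I -> vertex (Kbip a n)) :
    \sum_i `|x (f i)| <= 1 -> \sum_i `|y (f i)| <= 1 ->
    \sum_i `|(l%:num *: x + (1 - l%:num) *: y) (f i)| <= 1.
    move=> hx hy.
    apply: (@le_trans _ _ (l%:num * \sum_i `|x (f i)|
      + (1 - l%:num) * \sum_i `|y (f i)|)).
      rewrite !mulr_sumr -big_split /=; apply: ler_sum => i _.
      rewrite !ffunE (le_trans (ler_normD _ _)) // !normrM.
      by rewrite (ger0_norm l0) (ger0_norm l1).
    by nra.
  split; [|exact: (bnd _ inl)|exact: (bnd _ inr)].
  transitivity (l%:num * \sum_u x u + (1 - l%:num) * \sum_u y u).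
    by rewrite !mulr_sumr -big_split /=; apply: eq_bigr => u _; rewrite !ffunE.
  by rewrite x0 y0 !mulr0 addr0.
move=> _ [u [v [uv ->]]]; split.
- under eq_bigr => w _ do rewrite !ffunE.
  by rewrite big_split /= sumrN !sum_delta subrr.
- case: u v uv => [i|i] [j|j] // _.
    rewrite (eq_bigr (fun k => (k == i)%:R)) ?sum_delta // => k _.
    by rewrite !ffunE subr0 normr_nat.
  rewrite (eq_bigr (fun k => (k == j)%:R)) ?sum_delta // => k _.
  by rewrite !ffunE sub0r normrN normr_nat.
- case: u v uv => [i|i] [j|j] // _.
    rewrite (eq_bigr (fun k => (k == j)%:R)) ?sum_delta // => k _.
    by rewrite !ffunE sub0r normrN normr_nat.
  rewrite (eq_bigr (fun k => (k == i)%:R)) ?sum_delta // => k _.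
  by rewrite !ffunE subr0 normr_nat.
Qed.

(* The [l^1]-bounds force every coordinate into [-s, s], so that the lattice
   points are indexed by pairs of functions into ['I_(2 s + 1)]. *)
Definition bip_lattice a n s :
    {set {ffun 'I_n -> 'I_(s.*2.+1)} * {ffun 'I_a -> 'I_(s.*2.+1)}} :=
  [set p | [&& (norm1 p.1 <= s)%N, (norm1 p.2 <= s)%N
           & total p.2 + total p.1 == 0]].

Definition lattice_embedding (R : realType) a n s
    (p : {ffun 'I_n -> 'I_(s.*2.+1)} * {ffun 'I_a -> 'I_(s.*2.+1)}) :=
  bip_point R (fun i => centered (p.2 i)) (fun j => centered (p.1 j)).

Arguments lattice_embedding R {a n s} p.
Arguments bip_lattice : clear implicits.

Lemma centered_inj M : injective (@centered M).
Proof. by move=> i j /addIr [] /val_inj. Qed.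

Lemma centered_surj M (k : int) : (`|k| <= M)%N -> exists i, @centered M i = k.
Proof.
move=> kM; have h : (`|(k + M%:Z)%R| < M.*2.+1)%N by rewrite -addnn; lia.
by exists (Ordinal h); rewrite /centered /=; lia.
Qed.

Lemma lattice_embedding_inj (R : realType) a n s :
  injective (@lattice_embedding R a n s).
Proof.
move=> [z y] [z' y'] /ffunP e; congr pair; apply/ffunP => k; apply: centered_inj.
  by have := e (inr k); rewrite !ffunE => /intr_inj.
by have := e (inl k); rewrite !ffunE => /intr_inj.
Qed.

(** Scaling [polytope_bound] by [s] gives one inclusion, [bip_point_dilate] the other. *)
Lemma dilated_lattice_bip (R : realType) a n s :
  @dilated_lattice_points R (Kbip a.+1 n.+1) s
  = lattice_embedding R @` [set` bip_lattice a.+1 n.+1 s].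
Proof.
apply/seteqP; split=> [x [[x' Px' xE] xint]|_ [[z y] /= + <-]]; last first.
  rewrite inE => /and3P[/= zs ys /eqP yz0]; split.
    exact: (@bip_point_dilate R a n s (fun i => centered (y i))
      (fun j => centered (z j)) yz0 ys zs).
  by move=> u; rewrite ffunE; apply: intr_int.
have [x0 xl xr] := polytope_bound Px'.
pose m u := Num.floor (x u : R).
have xm u : x u = (m u)%:~R by rewrite floorK.
have msum (I : finType) (f : I -> vertex (Kbip a.+1 n.+1)) :
    \sum_i `|x' (f i)| <= 1 -> (\sum_i `|m (f i)| <= s)%N.
  move=> h; rewrite -(ler_nat R) natr_sum.
  rewrite (eq_bigr (fun i => s%:R * `|x' (f i)|)) => [|i _].
    by rewrite -mulr_sumr -[leRHS]mulr1 ler_wpM2l.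
  by rewrite natr_absz intr_norm -xm -xE !ffunE normrM normr_nat.
have mb (I : finType) (f : I -> vertex (Kbip a.+1 n.+1)) i :
    \sum_i `|x' (f i)| <= 1 -> (`|m (f i)| <= s)%N.
  by move=> /msum; rewrite (bigD1 i) //=; apply: leq_trans; apply: leq_addr.
have /choice[y yE] : forall i, exists k, @centered s k = m (inl i).
  by move=> i; apply/centered_surj/(mb _ inl).
have /choice[z zE] : forall j, exists k, @centered s k = m (inr j).
  by move=> j; apply/centered_surj/(mb _ inr).
exists (finfun z, finfun y); last first.
  by apply/ffunP => -[i|j]; rewrite !ffunE ?yE ?zE -xm.
rewrite /= inE /norm1 /total /=; apply/and3P; split.
- by under eq_bigr => j _ do rewrite ffunE zE; apply: msum.
- by under eq_bigr => i _ do rewrite ffunE yE; apply: msum.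
under eq_bigr => i _ do rewrite ffunE yE.
under [X in _ + X]eq_bigr => j _ do rewrite ffunE zE.
have <- : \sum_u m u = \sum_i m (inl i) + \sum_j m (inr j) by exact: big_sumType.
rewrite -(intr_eq0 R) rmorph_sum /=.
have -> : \sum_u (m u)%:~R = s%:R * \sum_u x' u :> R.
  by rewrite mulr_sumr; apply: eq_bigr => u _; rewrite -xm -xE ffunE.
by rewrite x0 mulr0.
Qed.

Lemma card_eq_finset (T : finType) (A : {set T}) : ([set` A] #= `I_#|A|)%card.
Proof.
rewrite (card_eqr card_II) (_ : [set` A] = @enum_val T (mem A) @` setT).
  by apply: inj_card_eq => i j _ _; apply: enum_val_inj.
apply/seteqP; split=> [x /= xA|_ [i _ <-]]; last exact: enum_valP.
by exists (enum_rank_in xA x) => //; rewrite enum_rankK_in.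
Qed.

Lemma card_dilated_lattice_bip (R : realType) a n s :
  (@dilated_lattice_points R (Kbip a.+1 n.+1) s
     #= `I_#|bip_lattice a.+1 n.+1 s|)%card.
Proof.
rewrite dilated_lattice_bip.
apply: card_eq_trans (card_eq_finset _).
by apply: inj_card_eq => p q _ _; apply: lattice_embedding_inj.
Qed.

Lemma card_bip_lattice (F : pzSemiRingType) a n s :
  #|bip_lattice a n s|%:R
  = ball_sum n s (fun k => ball_sum a s (fun j => (j + k == 0)%:R)) :> F.
Proof.
rewrite -(@ball_sum_ffun _ _ s) //.
under eq_bigr => z _ do rewrite -(@ball_sum_ffun _ _ s) //.
rewrite pair_big_dep /= -sum1_card natr_sum.
rewrite [RHS](eq_bigr (fun p => if total p.2 + total p.1 == 0 then 1 else 0)).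
  by rewrite -big_mkcondr; apply: eq_bigl => p; rewrite inE -andbA.
by move=> p _; case: eqP.
Qed.

(** * Passage to the critical line *)

Lemma map_meixner (F K : fieldType) (f : {rmorphism F -> K}) n :
  map_poly f (meixner F n) = meixner K n.
Proof.
suff [] : map_poly f (meixner F n) = meixner K n
  /\ map_poly f (meixner F n.+1) = meixner K n.+1 by [].
elim: n => [|n [h0 h1]]; first by rewrite /= rmorph1 map_polyX.
split=> //; rewrite !meixnerSS map_polyZ fmorphV rmorph_nat rmorphB rmorphM /=.
by rewrite map_polyX map_polyZ rmorph_nat h0 h1.
Qed.

Arguments meixner F n : simpl never.

Lemma map_H2_real (F K : fieldType) (f : {rmorphism F -> K}) m :
  map_poly f (H2_real F m) = H2_real K m.
Proof. by rewrite /H2_real rmorphB rmorphM /= map_polyX !map_meixner. Qed.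

Lemma map_H3_real (F K : fieldType) (f : {rmorphism F -> K}) m :
  map_poly f (H3_real F m) = H3_real K m.
Proof.
rewrite /H3_real !rmorphB /= !map_polyZ !rmorphM /= map_polyX !map_meixner.
rewrite map_H2_real /=.
by rewrite !(rmorphD f, rmorphM f, rmorphXn f, rmorph_nat f, rmorph1 f) /=.
Qed.

(** Putting [w = ii y] and extracting [ii ^+ n] turns the minus sign in the recurrence of [meixner]
    into the plus sign in that of [cross]. *)
Lemma meixner_cross (F : numFieldType) (ii w : F) n : ii ^+ 2 = -1 ->
  ii ^+ n * (meixner F n).[- ii * w] = cross w n.
Proof.
move=> i2; suff [] : ii ^+ n * (meixner F n).[- ii * w] = cross w n
  /\ ii ^+ n.+1 * (meixner F n.+1).[- ii * w] = cross w n.+1 by [].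
have iw : ii * (- ii * w) = w by rewrite mulrA mulrN -expr2 i2 opprK mul1r.
elim: n => [|n [h0 h1]].
  by rewrite /meixner hornerC hornerX expr0 expr1 mulr1 iw.
split=> //; apply: (mulfI (x := n.+2%:R)); first by rewrite pnatr_eq0.
rewrite crossSS -h0 -h1 meixnerSS hornerZ hornerD hornerN hornerM hornerX hornerZ.
rewrite mulrCA mulVKf ?pnatr_eq0 // mulrBr; congr (_ + _).
  by rewrite exprS mulrACA iw.
by rewrite -addn2 exprD i2; ring.
Qed.

Lemma horner_H2_cross (F : numFieldType) (ii w : F) m : ii ^+ 2 = -1 ->
  ii ^+ m.+2 / 2 * (H2_real F m).[- ii * w]
  = (w * cross w m.+1 + cross w m) / 2.
Proof.
move=> i2; rewrite horner_H2_real -!(meixner_cross _ _ i2) !exprS.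
rewrite (_ : ii * (ii * ii ^+ m) = - ii ^+ m); last first.
  by rewrite mulrA -expr2 i2 mulN1r.
move: (ii ^+ m) (_.[_]) (_.[_]) => x q1 q0.
by field.
Qed.

(** The sign of [w^2 = - y^2] goes into the constant, which leaves [H3_real] with a positive leading
    coefficient. *)
Lemma horner_H3_cross (F : numFieldType) (ii w : F) m (n : F := m.+1%:R) :
  ii ^+ 2 = -1 ->
  - ii ^+ m.+1 / (16 * (n + 1) * (n + 2)) * (H3_real F m).[- ii * w]
  = ((3 * n ^+ 2 + 7 * n + 6) * (w ^+ 2 * cross w m.+1)
     + (4 * n ^+ 2 + 18 * n + 12) * (w * cross w m)
     + (n + 1) * (9 * n + 14) * cross w m.+1) / (16 * (n + 1) * (n + 2)).
Proof.
move=> i2; rewrite horner_H3_real horner_H2_real -/n.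
rewrite -!(meixner_cross _ _ i2) [ii ^+ m.+1]exprS.
set y := - ii * w.
have -> : w = ii * y by rewrite mulrA mulrN -expr2 i2 opprK mul1r.
rewrite exprMn i2.
have n1 : n + 1 != 0 by rewrite /n natr1 pnatr_eq0.
have n2 : n + 2 != 0 by rewrite /n -natrD addn2 pnatr_eq0.
move: n n1 n2 (ii ^+ m) y (_.[_]) (_.[_]) => n n1 n2 x y q1 q0.
by field; rewrite n1 n2.
Qed.

(* The substitution [z = (-1 + i y) / 2] carries the real axis to the critical
   line. *)
Definition on_critical_line (R : realType) (c : R[i]) (f : {poly R}) : {poly R[i]} :=
  c *: (map_poly (real_complex R) f \Po (- 'i *: (2 *: 'X + 1))).

Lemma horner_on_critical_line (R : realType) (c : R[i]) (f : {poly R}) z :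
  (on_critical_line c f).[z]
  = c * (map_poly (real_complex R) f).[- 'i * (2 * z + 1)].
Proof. by rewrite hornerZ horner_comp !hornerE. Qed.

(** With direction ['i / 2] the parameter is the real variable [y] itself, so real zeros serve
    directly as parameters on the line. *)
Definition critical_point (R : realType) : R -> R[i] :=
  line_point (- 2^-1) ('i / 2).

Lemma critical_point_subst (R : realType) (t : R) :
  - 'i * (2 * critical_point t + 1) = t%:C.
Proof.
rewrite /critical_point /line_point.
rewrite (_ : 2 * (- 2^-1 + t%:C * ('i / 2)) + 1 = 'i * t%:C); last by field.
by rewrite mulrA mulNr -expr2 sqr_i opprK mul1r.
Qed.

Lemma critical_point_inj (R : realType) : injective (@critical_point R).
Proof.
move=> x y e; apply: (@complexI R).
by rewrite -!critical_point_subst e.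
Qed.

Lemma range_critical_point (R : realType) :
  critical_line R = range (@critical_point R).
Proof.
apply/seteqP; split=> [z zL|_ [t _ <-]].
  exists (2 * complex.Im z) => //.
  rewrite [RHS]complexE zL /critical_point /line_point.
  have swap (a b : R[i]) : 2 * a * (b / 2) = b * a by field.
  by rewrite rmorphN fmorphV rmorphM !rmorph_nat; congr (_ + _); apply: swap.
rewrite /critical_line /critical_point /line_point /=; simpc.
by rewrite expr0n addr0; field.
Qed.

(** The affine substitution preserves the degree, so the images of the [size t] distinct zeros
    exhaust it and give the full factorization with multiplicities. *)
Lemma on_critical_line_zeros (R : realType) (c : R[i]) (f : {poly R}) (t : seq R)
    (H := on_critical_line c f) :
  c != 0 -> size f = (size t).+1 -> uniq t -> all (root f) t ->
  size H = size f /\ lists_zeros H (map (@critical_point R) t).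
Proof.
move=> c0 sf ut ft.
have sH : size H = size f.
  rewrite /H size_scale // size_comp_poly2 ?size_map_poly //.
  rewrite size_scale ?oppr_eq0 ?neq0Ci // size_polyDl.
    by rewrite size_scale // size_polyX.
  by rewrite size_scale // size_polyX size_poly1.
split=> //; have H0 : H != 0 by rewrite -size_poly_gt0 sH sf.
split=> // z; rewrite -mu_prod_XsubC.
have -> : H = lead_coef H *: \prod_(x <- map (@critical_point R) t) ('X - x%:P).
  apply: all_roots_prod_XsubC; first by rewrite sH size_map.
    apply/allP => _ /mapP[x xt ->]; rewrite rootE horner_on_critical_line.
    rewrite critical_point_subst horner_map (eqP (allP ft x xt)) rmorph0 mulr0.
    by rewrite eqxx.
  by rewrite uniq_rootsE map_inj_uniq //; apply: critical_point_inj.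
by rewrite -mul_polyC mupMr // rootC lead_coef_eq0.
Qed.

(** * The two Ehrhart polynomials and their interlacing *)

Lemma ehrhart_K2 (R : realType) m :
  ehrhart_poly R (Kbip 2 m.+1) = on_critical_line ('i ^+ m.+2 / 2) (H2_real R m).
Proof.
(* By uniqueness of the Ehrhart polynomial, agreement of values at all natural [s] suffices. *)
apply: ehrhart_polyE => s; exists #|bip_lattice 2 m.+1 s|.
split; first exact: card_dilated_lattice_bip.
rewrite card_bip_lattice ball_sum_H2 horner_on_critical_line map_H2_real.
by rewrite (horner_H2_cross _ _ (sqr_i R)).
Qed.

Lemma ehrhart_K3 (R : realType) m (n : R[i] := m.+1%:R) :
  ehrhart_poly R (Kbip 3 m.+1)
  = on_critical_line (- 'i ^+ m.+1 / (16 * (n + 1) * (n + 2))) (H3_real R m).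
Proof.
apply: ehrhart_polyE => s; exists #|bip_lattice 3 m.+1 s|.
split; first exact: card_dilated_lattice_bip.
rewrite card_bip_lattice ball_sum_H3 horner_on_critical_line map_H3_real -/n.
by rewrite (horner_H3_cross _ _ (sqr_i R)).
Qed.

Theorem theorem4p9 (R : realType) (n : nat) (n_ge1 : (1 <= n)%N) :
  (forall z : R[i], root (ehrhart_poly R (Kbip 3 n)) z -> critical_line R z)
  /\ interlaced (critical_line R)
       (ehrhart_poly R (Kbip 3 n)) (ehrhart_poly R (Kbip 2 n)).
Proof.
case: n n_ge1 => // m _; rewrite ehrhart_K2 ehrhart_K3.
have i0 : 'i != 0 :> R[i] by rewrite -sqrf_eq0 sqr_i oppr_eq0 oner_eq0.
have c3_neq0 : - 'i ^+ m.+1 / (16 * (m.+1%:R + 1) * (m.+1%:R + 2)) != 0 :> R[i].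
  apply: mulf_neq0; first by rewrite oppr_eq0 expf_neq0.
  rewrite natr1 -natrD invr_eq0; apply: mulf_neq0; last by rewrite pnatr_eq0.
  by apply: mulf_neq0; rewrite pnatr_eq0.
have c2_neq0 : 'i ^+ m.+2 / 2 != 0 :> R[i].
  by rewrite mulf_neq0 ?expf_neq0 // invr_eq0 pnatr_eq0.
have [t [s [ts Ht Hs [st ss _ _]]]] := H3_real_interlaced R m.
have [size3 zeros3] :=
  on_critical_line_zeros c3_neq0 st (alternate_uniql ts) Ht.
have [size2 zeros2] :=
  on_critical_line_zeros c2_neq0 ss (alternate_uniqr ts) Hs.
split=> [z z3|].
  (* A zero has positive multiplicity, hence occurs in the list. *)
  have : z \in map (@critical_point R) t.
    rewrite -has_pred1 has_count zeros3.2 -XsubC_dvd ?zeros3.1 //.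
    by rewrite dvdp_XsubCl.
  by rewrite range_critical_point => /mapP[x _ ->]; exists x.
exists (- 2^-1), ('i / 2); split.
- by rewrite mulf_neq0 // invr_eq0 pnatr_eq0.
- exact: range_critical_point.
- by rewrite size3 size2 st ss ts.1.
exists t, s; split=> // j /ts.2 /andP[h1 h2].
by rewrite !ltW.
Qed.
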